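(* Let $G = \langle g_1, g_2\rangle$ be the free group of rank $2$ with free generators $g_1,g_2$. Let $\Upsilon$ be the Cayley graph of $G$ with respect to the free generators $g_1,g_2$. Then there is a sequence of infinite index quasiconvex subgroups $H_k\subset G$ such that $$\lim_{k\to\infty}\lambda_{H_k}(\Upsilon) = 3 = \lambda_G(\Upsilon).$$
   Context: $\Upsilon$ carries its graph metric $d_\Upsilon$ (edges of length $1$). Fix a basepoint $b\in\Upsilon$. For a subset $H\subset G$ let $$f_{H,\Upsilon}(n) = \#\{h\in H : d_\Upsilon(b,h(b))\le n\}, \qquad \lambda_H(\Upsilon) = \limsup_{n\to\infty} \sqrt[n]{f_{H,\Upsilon}(n)};$$ the latter does not depend on $b$. *)

(* Defs.v *)
From HB Require Import structures.
From mathcomp Require Import all_boot all_order all_algebra finmap.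
From mathcomp Require Import all_classical all_reals all_analysis.

Set Implicit Arguments.
Unset Strict Implicit.
Unset Printing Implicit Defensive.

Import Order.TTheory GRing.Theory Num.Theory.
Import numFieldNormedType.Exports.

Local Open Scope classical_set_scope.
Local Open Scope ring_scope.

Section Graphs.
Variables (V : eqType) (e : rel V).

(* p lists the vertices after x; the path has (size p) edges. *)
Definition path_between (x y : V) (p : seq V) : Prop :=
  path e x p /\ last x p = y.

(* The default value 0 is only taken when x and y are not connected. *)
Definition gdist (x y : V) : nat :=
  xget 0%N [set n | (exists2 p, path_between x y p & size p = n)
                    /\ forall q, path_between x y q -> (n <= size q)%N].

Definition geodesic (x y : V) (p : seq V) : Prop :=
  path_between x y p /\ size p = gdist x y.

Definition quasiconvex (Y : set V) : Prop :=
  exists K : nat, forall x y p, Y x -> Y y -> geodesic x y p ->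
    forall v, v \in x :: p -> exists2 z, Y z & (gdist v z <= K)%N.

End Graphs.

Section Growth.
Variables (G : choiceType) (V : eqType) (act : G -> V -> V) (e : rel V) (b : V).

Definition orbit_ball (H : set G) (n : nat) : set G :=
  [set h | H h /\ (gdist e b (act h b) <= n)%N].

(* [fset_set] sends infinite sets to the empty set; orbit balls are finite when
   [act] is a proper action, as for a finitely generated group acting on its
   Cayley graph. *)
Definition growth_fun (H : set G) (n : nat) : nat :=
  #|` fset_set (orbit_ball H n)|%fset.

Definition growth_rate (R : realType) (H : set G) : \bar R :=
  limn_esup (fun n : nat => ((growth_fun H n)%:R `^ n%:R^-1)%:E).

End Growth.

Section Groups.
Variable G : groupType.

Definition subgroup (H : set G) : Prop :=
  group_closed [in H].

Definition left_coset (g : G) (H : set G) : set G := [set (g * h)%g | h in H].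

Definition infinite_index (H : set G) : Prop :=
  infinite_set [set left_coset g H | g in [set: G]].

Definition free_generators (I : Type) (g : I -> G) : Prop :=
  forall (K : groupType) (k : I -> K),
    exists! f : G -> K, {morph f : x y / (x * y)%g} /\ forall i, f (g i) = k i.

(* Edges join x to x * g_i, so that G acts by left multiplication. *)
Definition cayley (I : finType) (g : I -> G) : rel G :=
  fun x y => [exists i, (y == x * g i)%g || (x == y * g i)%g].

Definition cayley_growth_rate (R : realType) (I : finType) (g : I -> G) (b : G)
    (H : set G) : \bar R :=
  growth_rate (fun h x : G => (h * x)%g) (cayley g) b R H.

End Groups.

(* Main.v *)
Require Import Defs.
From HB Require Import structures.
From mathcomp Require Import all_boot all_order all_algebra finmap.
From mathcomp Require Import all_classical all_reals all_analysis.
From mathcomp Require Import zify ring lra.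

Set Implicit Arguments.
Unset Strict Implicit.
Unset Printing Implicit Defensive.

Import Order.TTheory GRing.Theory Num.Theory.
Import numFieldNormedType.Exports.

Local Open Scope classical_set_scope.
Local Open Scope ring_scope.

(** The subgroup [H k] consists of the elements written by words in [a], [b] whose
    running [a]-exponent starts and ends at [0] and never exceeds [2(k + 2)] in
    absolute value. In terms of coverings, the kernel of the map from the free
    group to the integers sending [a] to [1] and [b] to [0] corresponds to a line
    of [a]-edges with a [b]-loop at each vertex, and [H k] is the fundamental
    group of a finite segment of this line.

    The index is infinite because [H k] lies in that kernel, and [H k] is
    quasiconvex because free reduction keeps a word in the strip
    ([stays_reduce]), so that a geodesic between points of [H k] remains within
    [2(k + 2)] of [H k].

    The growth rate of any subset is at most [3], since there are at most
    [4 * 3 ^ n] reduced words of length at most [n] ([growth_upper]). That the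
    rate of [H k] tends to [3] reflects the amenability of the integers, but a
    direct count suffices. Among [3 ^ k] reduced words of length [k + 2], at
    least a fraction [1 / (2k + 5)] have the same [a]-exponent; following one of
    these by the image of another under the automorphism inverting [a] produces
    loops of length [2(k + 2)] in the strip ([loops]). They all end with [b] and
    can follow [b] without cancellation, so they concatenate freely and generate
    a free monoid inside [H k] ([growth_lower]). Hence the rate is at least
    [(3 ^ k / (2k + 5)) ^ (1 / (k + 2))], which tends to [3] ([rate_ge]).

    Both the distances in the Cayley graph and the distinctness of the elements
    counted rest on the normal form theorem, deduced from the universal property
    in [normal_form]. *)

(** A letter [(i, c)] stands for the generator [i], inverted when [c] holds. *)
Local Notation letter I := (I * bool)%type.

(** * Words and free reduction *)

Section Words.
Variable I : eqType.

Implicit Types (l : letter I) (s t : seq (letter I)).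

Definition linv l : letter I := (l.1, ~~ l.2).

Lemma linvK : involutive linv.
Proof. by case=> i c; rewrite /linv /= negbK. Qed.

Definition no_cancel l l' := l' != linv l.

Definition reduced s := sorted no_cancel s.

Definition winv s := rev (map linv s).

Lemma winv_cons l s : winv (l :: s) = winv s ++ [:: linv l].
Proof. by rewrite /winv /= rev_cons cats1. Qed.

Lemma size_winv s : size (winv s) = size s.
Proof. by rewrite size_rev size_map. Qed.

(** Left multiplication by a letter, computed on reduced words. *)
Definition push l s :=
  if s is l' :: s' then if l' == linv l then s' else l :: s else [:: l].

Lemma push_reduced l s : reduced s -> reduced (push l s).
Proof.
rewrite /push; case: s => [//|l' s] red_s; case: eqP => [_|/eqP ne].
  by case: s red_s => [//|l'' s] /= /andP[].
by rewrite /reduced /= /no_cancel ne.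
Qed.

(** Each letter acts by a permutation of the reduced words: van der Waerden's
    way to the normal form theorem, which avoids proving that concatenation
    followed by reduction is associative. *)
Lemma pushK l s : reduced s -> push (linv l) (push l s) = s.
Proof.
rewrite /push; case: s => [_|l' s]; first by rewrite linvK eqxx.
case: (eqVneq l' (linv l)) => [->|ne _]; last by rewrite linvK eqxx.
case: s => [//|l'' s] /= /andP[+ _].
by rewrite /no_cancel => /negPf ->.
Qed.

Definition reduce s := foldr push [::] s.

Lemma reduce_reduced s : reduced (reduce s).
Proof. by elim: s => [//|l s IHs] /=; apply: push_reduced. Qed.

Lemma reduce_id s : reduced s -> reduce s = s.
Proof.
elim: s => [//|l s IHs] red_ls /=.
have red_s: reduced s by move: red_ls; rewrite /reduced /=; apply: path_sorted.
rewrite IHs //; case: s red_ls {IHs red_s} => [//|l' s] /= /andP[+ _].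
by rewrite /no_cancel => /negPf ->.
Qed.

Lemma size_push l s : (size (push l s) <= (size s).+1)%N.
Proof.
by rewrite /push; case: s => [//|l' s]; case: eqP => //= _; rewrite ltnW.
Qed.

Lemma size_reduce s : (size (reduce s) <= size s)%N.
Proof. by elim: s => [//|l s IHs] /=; apply: leq_trans (size_push _ _) _. Qed.

(** Reduction strictly shortens a word that is not reduced, so a word labelling
    a geodesic is reduced. *)
Lemma reduce_eq_of_size s : size (reduce s) = size s -> reduce s = s.
Proof.
elim: s => [//|l s IHs] /= sz.
have le_s := size_reduce s.
have eq_s : reduce s = s.
  apply: IHs; apply/eqP; rewrite eqn_leq le_s /=.
  by rewrite -ltnS -sz size_push.
move: sz; rewrite eq_s; case: s {le_s eq_s IHs} => [//|l' s] /=.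
by case: eqP => //= _; lia.
Qed.

End Words.

(** * Normal forms in a free group *)

Section FreeGroup.
Variables (I : finType) (G : groupType) (g : I -> G).
Local Notation word := (seq (letter I)).
Implicit Types (l : letter I) (s t : word) (x y z : G).

Definition lval l : G := if l.2 then (g l.1)^-1%g else g l.1.

Lemma lval_inv l : lval (linv l) = (lval l)^-1%g.
Proof. by case: l => i [] /=; rewrite /lval /= ?invgK. Qed.

Definition ev s : G := foldr (fun l x => (lval l * x)%g) 1%g s.

Lemma ev_cat s t : ev (s ++ t) = (ev s * ev t)%g.
Proof. by elim: s => [|l s IHs] /=; rewrite ?mul1g // IHs mulgA. Qed.

Lemma ev_winv s : ev (winv s) = (ev s)^-1%g.
Proof.
elim: s => [|l s IHs]; first by rewrite invg1.
by rewrite winv_cons ev_cat IHs /= mulg1 lval_inv invgM.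
Qed.

Lemma ev_push l s : ev (push l s) = (lval l * ev s)%g.
Proof.
rewrite /push; case: s => [//|l' s]; case: eqP => [->|//] /=.
by rewrite lval_inv mulgA mulgV mul1g.
Qed.

Lemma ev_reduce s : ev (reduce s) = ev s.
Proof. by elim: s => [//|l s IHs] /=; rewrite ev_push IHs. Qed.

Definition rword := {s : word | reduced s}.

Definition rpush l (s : rword) : rword :=
  exist _ (push l (val s)) (push_reduced l (valP s)).

Lemma rpushK l : cancel (rpush l) (rpush (linv l)).
Proof. by move=> s; apply/val_inj/pushK/valP. Qed.

Lemma rpushVK l : cancel (rpush (linv l)) (rpush l).
Proof. by move=> s; have := rpushK (linv l) s; rewrite linvK. Qed.

(** A lift of [base] is a permutation of the reduced words that agrees with left
    multiplication by [base] once words are evaluated in [G]. Lifts form a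
    group, and the universal property maps [G] to it. Because the lift remembers
    its base point, a single homomorphism shows both that every element is the
    value of a word and that reduced words with equal values coincide. *)
Record lift := Lift {
  fwd : rword -> rword;
  bwd : rword -> rword;
  base : G;
  fwdK : cancel fwd bwd;
  bwdK : cancel bwd fwd;
  fwd_ev : forall s : rword, ev (val (fwd s)) = (base * ev (val s))%g }.

HB.instance Definition _ := gen_eqMixin lift.
HB.instance Definition _ := gen_choiceMixin lift.

Lemma lift_eq (u v : lift) : fwd u =1 fwd v -> base u = base v -> u = v.
Proof.
case: u => f f' x fK f'K fx; case: v => h h' y hK h'K hy /= /funext eq_f eq_x.
subst h y; have eq_f' : f' = h' by apply/funext=> s; rewrite -{1}(h'K s) fK.
by subst h'; congr Lift; apply: Prop_irrelevance.
Qed.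

Fact lift_one_ev (s : rword) : ev (val s) = (1 * ev (val s))%g.
Proof. by rewrite mul1g. Qed.

Definition lift_one : lift :=
  @Lift id id 1%g (fun=> erefl) (fun=> erefl) lift_one_ev.

Fact lift_mul_ev (u v : lift) (s : rword) :
  ev (val (fwd u (fwd v s))) = (base u * base v * ev (val s))%g.
Proof. by rewrite !fwd_ev mulgA. Qed.

Definition lift_mul (u v : lift) : lift :=
  @Lift (fwd u \o fwd v) (bwd v \o bwd u) (base u * base v)%g
    (can_comp (@fwdK u) (@fwdK v)) (can_comp (@bwdK v) (@bwdK u))
    (lift_mul_ev u v).

Fact lift_inv_ev (u : lift) (s : rword) :
  ev (val (bwd u s)) = ((base u)^-1 * ev (val s))%g.
Proof. by rewrite -{2}(bwdK u s) fwd_ev mulgA mulVg mul1g. Qed.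

Definition lift_inv (u : lift) : lift :=
  @Lift (bwd u) (fwd u) (base u)^-1%g (@bwdK u) (@fwdK u) (lift_inv_ev u).

Definition lift_letter l : lift :=
  @Lift (rpush l) (rpush (linv l)) (lval l) (rpushK l) (rpushVK l)
    (fun s : rword => ev_push l (val s)).

Fact lift_mulA : associative lift_mul.
Proof. by move=> u v w; apply: lift_eq => //=; rewrite mulgA. Qed.
Fact lift_mul1 : left_id lift_one lift_mul.
Proof. by move=> u; apply: lift_eq => //=; rewrite mul1g. Qed.
Fact lift_mul1r : right_id lift_one lift_mul.
Proof. by move=> u; apply: lift_eq => //=; rewrite mulg1. Qed.
Fact lift_mulV : left_inverse lift_one lift_inv lift_mul.
Proof. by move=> u; apply: lift_eq => [s|] /=; rewrite ?mulVg ?fwdK. Qed.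
Fact lift_mulVr : right_inverse lift_one lift_inv lift_mul.
Proof. by move=> u; apply: lift_eq => [s|] /=; rewrite ?mulgV ?bwdK. Qed.

HB.instance Definition _ := isGroup.Build lift
  lift_mulA lift_mul1 lift_mul1r lift_mulV lift_mulVr.

Hypothesis hg : free_generators g.

(** Let [phi] send each generator to its lift. Composed with [base], it is an
    endomorphism of [G] that fixes the generators, so [phi x] is a lift of [x].
    Applying [phi x] to the empty word gives a reduced word with value [x], and
    for [x = ev s] this word is computed letter by letter as [reduce s]. *)
Lemma normal_form : exists nf : G -> word,
  [/\ forall x, reduced (nf x), forall x, ev (nf x) = x
    & forall s, nf (ev s) = reduce s].
Proof.
have [phi [[phiM phig] _]] := hg (fun i => lift_letter (i, false)).
have phi1 : phi 1%g = 1%g.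
  by apply: (@mulgI _ (phi 1%g)); rewrite -phiM !mulg1.
have phiV x : phi x^-1%g = (phi x)^-1%g.
  by apply: (@mulgI _ (phi x)); rewrite -phiM !mulgV.
have base_phi x : base (phi x) = x.
  have [f [_ funiq]] := hg g.
  have fE : f = (fun x => base (phi x)).
    by apply: funiq; split=> [y z|i]; rewrite ?phiM ?phig.
  have fid : f = id by apply: funiq.
  by have := congr1 (fun h => h x) fE; rewrite fid.
have phil l : phi (lval l) = lift_letter l.
  case: l => i [] /=; rewrite /lval /= ?phig // phiV phig.
  by apply: lift_eq => [s|].
pose nil0 : rword := exist _ [::] isT.
exists (fun x => val (fwd (phi x) nil0)); split=> [x|x|s].
- exact: valP.
- by rewrite fwd_ev base_phi mulg1.
- by elim: s => [|l s IHs] /=; rewrite ?phi1 // phiM phil /= IHs.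
Qed.

Lemma ev_surj x : exists s, x = ev s.
Proof. by have [nf [_ nfK _]] := normal_form; exists (nf x). Qed.

Lemma ev_inj_reduce s t : ev s = ev t -> reduce s = reduce t.
Proof. by have [nf [_ _ nf_ev]] := normal_form; rewrite -!nf_ev => ->. Qed.

(** * The Cayley graph of a free group *)

Definition trace x s : seq G := scanl (fun y l => (y * lval l)%g) x s.

Lemma cayleyP x y : reflect (exists l, y = (x * lval l)%g) (cayley g x y).
Proof.
apply: (iffP existsP) => [[i /orP[/eqP->|/eqP->]]|[[i []] ->]].
- by exists (i, false).
- by exists (i, true); rewrite /lval /= mulgK.
- by exists i; rewrite /lval /= mulgVK eqxx orbT.
- by exists i; rewrite /lval /= eqxx.
Qed.

Lemma path_trace x s : path_between (cayley g) x (x * ev s)%g (trace x s).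
Proof.
elim: s x => [|l s IHs] x; first by rewrite /= mulg1.
have [pth lst] := IHs (x * lval l)%g; split => /=.
  by rewrite pth andbT; apply/cayleyP; exists l.
by rewrite lst mulgA.
Qed.

Lemma trace_of_path x y p : path_between (cayley g) x y p ->
  exists2 s, p = trace x s & y = (x * ev s)%g.
Proof.
elim: p x => [|z p IHp] x [/=].
  by move=> _ <-; exists [::]; rewrite ?mulg1.
case/andP=> /cayleyP[l ->] pth lst.
have [s -> ->] := IHp _ (conj pth lst).
by exists (l :: s); rewrite //= mulgA.
Qed.

Lemma mem_trace x s y : y \in x :: trace x s ->
  exists s1 s2, s = s1 ++ s2 /\ y = (x * ev s1)%g.
Proof.
elim: s x => [|l s IHs] x.
  by rewrite inE => /eqP ->; exists [::], [::]; rewrite mulg1.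
rewrite in_cons => /orP[/eqP->|/IHs[s1 [s2 [-> ->]]]].
  by exists [::], (l :: s); rewrite mulg1.
by exists (l :: s1), s2; rewrite /= mulgA.
Qed.

(** Any path from [x] to [x * ev s] is labelled by a word with the reduction of
    [s], hence is at least as long as this reduction, which itself labels a
    path. *)
Lemma gdist_cayley x s : gdist (cayley g) x (x * ev s)%g = size (reduce s).
Proof.
have least q : path_between (cayley g) x (x * ev s)%g q ->
    (size (reduce s) <= size q)%N.
  move=> /trace_of_path[t -> /mulgI /ev_inj_reduce ->].
  by rewrite size_scanl size_reduce.
apply: xget_unique; first split=> //.
  exists (trace x (reduce s)); last by rewrite size_scanl.
  by rewrite -ev_reduce; apply: path_trace.
move=> n [[q qP <-] qmin]; apply/eqP; rewrite eqn_leq least // andbT.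
rewrite -(size_scanl (fun y l => (y * lval l)%g) x (reduce s)); apply: qmin.
by rewrite -ev_reduce; apply: path_trace.
Qed.

End FreeGroup.

(** * The strip subgroups *)

Section Strip.
Local Notation word := (seq (letter 'I_2)).
Implicit Types (l : letter 'I_2) (s t : word).

Definition a_letter : letter 'I_2 := (ord0, false).
Definition b_letter : letter 'I_2 := (ord_max, false).

(** Heights record the exponent sum of the generator [a = g ord0]; the generator
    [b = g ord_max] moves horizontally. *)
Definition height l : int :=
  if l.1 == ord0 then if l.2 then -1 else 1 else 0.

Lemma height_inv l : height (linv l) = - height l.
Proof. by case: l => i []; rewrite /height /=; case: ifP; rewrite ?oppr0. Qed.

Lemma height_le1 l : `|height l| <= 1.
Proof. by case: l => i []; rewrite /height /=; case: ifP. Qed.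

Definition rise s : int := \sum_(l <- s) height l.

Lemma rise_cons l s : rise (l :: s) = height l + rise s.
Proof. by rewrite /rise big_cons. Qed.

Lemma rise_cat s t : rise (s ++ t) = rise s + rise t.
Proof. by rewrite /rise big_cat. Qed.

Lemma rise_winv s : rise (winv s) = - rise s.
Proof.
elim: s => [|l s IHs]; first by rewrite /rise big_nil oppr0.
rewrite winv_cons rise_cat rise_cons IHs /rise big_seq1 height_inv.
by rewrite opprD addrC.
Qed.

Lemma rise_nseq n l : rise (nseq n l) = height l *+ n.
Proof.
elim: n => [|n IHn]; first by rewrite /rise big_nil.
by rewrite mulrS /= rise_cons IHn.
Qed.

Lemma norm_rise s : `|rise s| <= (size s)%:Z.
Proof.
elim: s => [|l s IHs]; first by rewrite /rise big_nil.
by rewrite rise_cons /=; have := height_le1 l; lia.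
Qed.

Lemma rise_push l s : rise (push l s) = height l + rise s.
Proof.
rewrite /push; case: s => [|l' s]; first by rewrite rise_cons.
by case: eqP => [->|_]; rewrite !rise_cons // height_inv addNKr.
Qed.

Lemma rise_reduce s : rise (reduce s) = rise s.
Proof.
by elim: s => [//|l s IHs] /=; rewrite rise_push IHs /rise big_cons.
Qed.

(** [stays k e s f]: the word [s] read from height [e] ends at height [f] and
    never leaves the strip of heights between [-k] and [k]. This says that [s]
    labels a path from [e] to [f] in the finite graph with vertices [-k..k], an
    [a]-edge between consecutive vertices, and a [b]-loop at each vertex. *)
Fixpoint stays (k : nat) (e : int) s (f : int) : bool :=
  (`|e| <= k%:Z) &&
  (if s is l :: s' then stays k (e + height l) s' f else e == f).

Lemma stays_bound k e s f : stays k e s f -> `|e| <= k%:Z.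
Proof. by case: s => [|l s] /andP[]. Qed.

Lemma stays_cat k e s t f :
  stays k e (s ++ t) f = stays k e s (e + rise s) && stays k (e + rise s) t f.
Proof.
elim: s e => [|l s IHs] e /=.
  rewrite /rise big_nil addr0 eqxx andbT.
  by case: (boolP (stays k e t f)) => [/stays_bound ->|]; rewrite ?andbF.
by rewrite IHs /rise big_cons addrA andbA.
Qed.

Lemma stays_rise k e s f : stays k e s f -> f = e + rise s.
Proof.
elim: s e => [|l s IHs] e /= /andP[_]; rewrite /rise ?big_nil ?big_cons.
  by move=> /eqP <-; rewrite addr0.
by move=> /IHs ->; rewrite addrA.
Qed.

Lemma stays_winv k e s f : stays k e s f -> stays k f (winv s) e.
Proof.
elim: s e => [|l s IHs] e /= /andP[e_le].
  by move=> /eqP <-; rewrite e_le eqxx.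
move=> stays_s; have /stays_rise fE := IHs _ stays_s.
rewrite winv_cons stays_cat -fE IHs //= height_inv addrK e_le eqxx.
by rewrite (stays_bound stays_s).
Qed.

Lemma stays_push k e l s f :
  `|e| <= k%:Z -> stays k (e + height l) s f -> stays k e (push l s) f.
Proof.
move=> e_le; rewrite /push; case: s => [|l' s]; first by rewrite /= e_le.
case: eqP => [->|_]; last by rewrite /= e_le.
by move=> /= /andP[_]; rewrite height_inv addrK.
Qed.

(** Deleting a cancelling pair only removes visited heights. *)
Lemma stays_reduce k e s f : stays k e s f -> stays k e (reduce s) f.
Proof.
elim: s e => [//|l s IHs] e /= /andP[e_le stays_s].
by apply: stays_push => //; apply: IHs.
Qed.

Lemma stays_short k e s :
  `|e| + (size s)%:Z <= k%:Z -> stays k e s (e + rise s).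
Proof.
elim: s e => [|l s IHs] e /= bound.
  by rewrite /rise big_nil addr0 eqxx andbT; lia.
have := height_le1 l => hl; rewrite rise_cons addrA IHs ?andbT; lia.
Qed.

Lemma stays_straight k e : `|e| <= k%:Z ->
  stays k e (nseq `|e|%N (ord0, (0 < e)%R)) 0.
Proof.
have straight n c (d := if c then n%:Z else - n%:Z : int) :
    (n <= k)%N -> stays k d (nseq n (ord0, c)) 0.
  rewrite /d {d}; elim: n => [|n IHn] le_nk; first by case: c; rewrite /=; lia.
  rewrite /=; apply/andP; split; first by case: c {IHn}; lia.
  have -> : (if c then n.+1%:Z else - n.+1%:Z) + height (ord0, c)
          = if c then n%:Z else - n%:Z by rewrite /height /=; case: c {IHn}; lia.
  by apply: IHn; apply: ltnW.
move=> e_le; have := @straight `|e|%N (0 < e)%R; case: ltP => e0.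
  by rewrite gtz0_abs //; apply; lia.
have -> : - `|e|%:Z = e by lia.
by apply; lia.
Qed.

Variables (G : groupType) (g : 'I_2 -> G).

(** The fundamental group, based at height [0], of the graph behind [stays], seen
    as a subgroup of the free group; it is generated by the conjugates
    [a^i b a^-i] with [|i| <= k]. *)
Definition strip k : set G := [set x | exists2 s, stays k 0 s 0 & x = ev g s].

Lemma strip_subgroup k : subgroup (strip k).
Proof.
split; first by apply/mem_set; exists [::]; rewrite //= normr0 eqxx andbT.
move=> x y /set_mem[s ss ->] /set_mem[t st ->]; apply/mem_set.
exists (s ++ winv t); last by rewrite ev_cat ev_winv.
by rewrite stays_cat -(stays_rise ss) ss stays_winv.
Qed.

Hypothesis hg : free_generators g.

Lemma strip_reduce k s : strip k (ev g s) -> stays k 0 (reduce s) 0.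
Proof. by case=> t st /(ev_inj_reduce hg) ->; apply: stays_reduce. Qed.

(** The exponent sum of [a] vanishes on the subgroup, so the powers of [a] lie in
    distinct cosets. *)
Lemma strip_infinite_index k : infinite_index (strip k).
Proof.
pose x n := ev g (nseq n a_letter).
have [S1 SB] := strip_subgroup k; have /set_mem strip1 := S1.
have coset_inj : injective (fun n => left_coset (x n) (strip k)).
  move=> m n eq_mn.
  have : left_coset (x n) (strip k) (x m).
    by rewrite -eq_mn; exists 1%g; rewrite ?mulg1.
  case=> h hS hE.
  have : strip k (ev g (winv (nseq n a_letter) ++ nseq m a_letter)).
    by rewrite ev_cat ev_winv -/(x n) -/(x m) -hE mulKg.
  move=> /strip_reduce /stays_rise; rewrite rise_reduce rise_cat rise_winv.
  by rewrite !rise_nseq /height /=; lia.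
move=> fin; apply: infinite_nat.
apply: sub_finite_set (finite_preimage (in2W coset_inj) fin) => n _ /=.
by exists (x n).
Qed.

(** A geodesic between two points of the subgroup is labelled by a reduced word
    that stays in the strip. At each of its vertices the current height is at
    most [k] in absolute value, and that many letters [a] or [a^-1] lead back to
    height [0], that is, to the subgroup. *)
Lemma strip_quasiconvex k : quasiconvex (cayley g) (strip k).
Proof.
exists k => _ _ p [s1 st1 ->] [s2 st2 ->] [/trace_of_path[s -> yE] sz] v.
move=> v_in.
have red_s : reduce s = s.
  apply: reduce_eq_of_size; rewrite -(gdist_cayley hg (ev g s1)) -yE -sz.
  exact: size_scanl.
have Ss : stays k 0 s 0.
  rewrite -red_s; apply: strip_reduce; exists (winv s1 ++ s2).
    by rewrite stays_cat -(stays_rise (stays_winv st1)) st2 stays_winv.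
  by rewrite ev_cat ev_winv yE mulKg.
have [t [t' [sE ->]]] := mem_trace v_in.
move: Ss; rewrite sE stays_cat add0r => /andP[st _].
have e_le : `|rise t| <= k%:Z by have := stays_bound (stays_winv st).
pose u : word := nseq `|rise t|%N (ord0, (0 < rise t)%R).
exists (ev g s1 * ev g t * ev g u)%g.
  exists (s1 ++ t ++ u); last by rewrite !ev_cat mulgA.
  rewrite stays_cat -(stays_rise st1) st1 stays_cat add0r st /=.
  exact: stays_straight.
rewrite (gdist_cayley hg); apply: leq_trans (size_reduce _) _.
by rewrite size_nseq; lia.
Qed.

End Strip.

(** * Counting words *)

Section Counting.
Local Notation word := (seq (letter 'I_2)).
Implicit Types (l : letter 'I_2) (s t u w : word).

Fixpoint ext l n : seq word :=
  if n is n'.+1 then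
    [seq l' :: s | l' <- enum [pred l' | no_cancel l l'], s <- ext l' n']
  else [:: [::]].

Lemma mem_ext l n s :
  (s \in ext l n) = (size s == n) && path (@no_cancel _) l s.
Proof.
elim: n l s => [|n IHn] l [|l' s] //=.
  by apply/negbTE/allpairsPdep => -[x [y []]].
rewrite eqSS; apply/allpairsPdep/andP=> [[x [y [xP yP [-> ->]]]]|[sz /andP[nc pth]]].
  by move: xP yP; rewrite mem_enum IHn inE => -> /andP[].
by exists l', s; split=> //; rewrite ?mem_enum // IHn sz.
Qed.

Lemma size_ext l n : size (ext l n) = (3 ^ n)%N.
Proof.
elim: n l => [//|n IHn] l /=; rewrite size_allpairs_dep sumnE big_map big_enum.
rewrite (eq_bigr (fun=> 3 ^ n)%N) => [|l' _]; last exact: IHn.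
rewrite sum_nat_const (@eq_card _ _ (predC1 (linv l))) //.
by rewrite cardC1 card_prod card_ord card_bool expnS.
Qed.

Lemma uniq_ext l n : uniq (ext l n).
Proof.
elim: n l => [//|n IHn] l /=; apply: allpairs_uniq_dep; rewrite ?enum_uniq //.
by move=> [x y] [x' y'] _ _ /= [-> ->].
Qed.

Fixpoint short l n : seq word :=
  if n is n'.+1 then short l n' ++ ext l n else [:: [::]].

Lemma mem_short l n s :
  (size s <= n)%N -> path (@no_cancel _) l s -> s \in short l n.
Proof.
elim: n => [|n IHn] sz pth; first by case: s sz pth.
rewrite mem_cat mem_ext pth andbT; move: sz; rewrite leq_eqVlt ltnS.
by case/orP=> [->|sz]; rewrite ?orbT // IHn.
Qed.

Lemma size_short l n : (size (short l n) <= 2 * 3 ^ n)%N.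
Proof.
elim: n => [//|n IHn]; rewrite (_ : short l n.+1 = short l n ++ ext l n.+1) //.
by rewrite size_cat size_ext expnS; lia.
Qed.

(** A reduced word cannot start with both [a] and [a^-1], so one of these two
    letters can precede it without cancellation. *)
Definition reduced_ball n := short a_letter n ++ short (linv a_letter) n.

Lemma mem_reduced_ball n s :
  (size s <= n)%N -> reduced s -> s \in reduced_ball n.
Proof.
case: s => [|l s] sz red_s; first by rewrite mem_cat mem_short.
have pth : path (@no_cancel _) l s by [].
rewrite mem_cat; case: (eqVneq l (linv a_letter)) => [lE|ne].
  by rewrite orbC mem_short //= pth andbT lE.
by rewrite mem_short //= pth /no_cancel ne.
Qed.

Lemma size_reduced_ball n : (size (reduced_ball n) <= 4 * 3 ^ n)%N.
Proof.
rewrite size_cat; have := size_short a_letter n.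
by have := size_short (linv a_letter) n; lia.
Qed.

Lemma pigeonhole (T : eqType) m (f : T -> 'I_m) (r : seq T) :
  (0 < m)%N ->
  exists i, (size r <= m * size [seq x <- r | f x == i])%N.
Proof.
case: m f => [//|m] f _.
have sum_size : size r = (\sum_(i < m.+1) size [seq x <- r | f x == i])%N.
  elim: r => [|x r IHr] /=; first by rewrite big1.
  rewrite IHr (bigD1 (f x)) //= [in RHS](bigD1 (f x)) //= eqxx addSn.
  congr (_ + _).+1%N.
  by apply: eq_bigr => i; rewrite eq_sym => /negPf ->.
pose i0 := [arg max_(i > ord0) size [seq x <- r | f x == i]]%N.
exists i0; set M := (X in (_ * X)%N); rewrite sum_size.
apply: (@leq_trans (\sum_(i < m.+1) M)%N).
  2: by rewrite sum_nat_const card_ord.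
by apply: leq_sum => i _; rewrite /M /i0; case: arg_maxnP => // j _; apply.
Qed.

(** The two appended letters make the word end in [b], so that such words can be
    concatenated without cancellation; the sign of the [a] is chosen to avoid
    cancelling the last letter of [s], where [b] stands for the last letter of
    an empty [s]. *)
Definition close s :=
  s ++ [:: if last b_letter s == linv a_letter then linv a_letter else a_letter;
        b_letter].

Lemma closeP n s : s \in ext b_letter n ->
  [/\ size (close s) = n.+2, path (@no_cancel _) b_letter (close s)
    & last b_letter (close s) = b_letter].
Proof.
rewrite mem_ext => /andP[/eqP sz pth]; split.
- by rewrite size_cat sz addn2.
- rewrite cat_path pth /= andbT; apply/andP; split; last by case: ifP.
  rewrite /no_cancel; case: ifP => [/eqP -> //|/eqP ne]; apply/eqP => aE.
  by apply: ne; rewrite aE linvK.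
- by rewrite last_cat.
Qed.

Lemma close_inj n : {in ext b_letter n &, injective close}.
Proof.
move=> s t; rewrite !mem_ext => /andP[/eqP sz _] /andP[/eqP tz _] /eqP.
by rewrite eqseq_cat ?sz ?tz // => /andP[/eqP].
Qed.

(** The automorphism of the free group that inverts [a] and fixes [b]. *)
Definition mirror l : letter 'I_2 := if l.1 == ord0 then linv l else l.

Lemma mirrorK : involutive mirror.
Proof.
case=> i c; rewrite /mirror /=.
by case E: (i == ord0); rewrite /= E ?linvK.
Qed.

Lemma no_cancel_mirror l l' : no_cancel (mirror l) (mirror l') = no_cancel l l'.
Proof.
rewrite /no_cancel; have -> : linv (mirror l) = mirror (linv l).
  by rewrite /mirror /=; case: ifP.
by rewrite (inj_eq (inv_inj mirrorK)).
Qed.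

Lemma rise_mirror s : rise (map mirror s) = - rise s.
Proof.
elim: s => [|l s IHs]; first by rewrite /rise big_nil oppr0.
rewrite /= !rise_cons IHs opprD; congr (_ + _).
rewrite /mirror; case: ifP => [_|l0]; first exact: height_inv.
by rewrite /height l0 oppr0.
Qed.

(** Among the [3 ^ n] closed words, at least a fraction [1 / (2n + 5)] share the
    same rise. Following one of them by the mirror image of another gives a word
    of rise [0], and the number of such pairs is the square. The loss is a
    polynomial factor, which disappears in the exponential growth rate. *)
Lemma loops n : exists S : seq word,
  [/\ uniq S, (3 ^ n * 3 ^ n <= (2 * n + 5) ^ 2 * size S)%N
    & forall s, s \in S -> [/\ size s = (2 * n.+2)%N,
        path (@no_cancel _) b_letter s, last b_letter s = b_letter
      & rise s = 0]].
Proof.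
pose W := map close (ext b_letter n).
have uniqW : uniq W by rewrite map_inj_in_uniq ?uniq_ext //; apply: close_inj.
have WP s : s \in W -> [/\ size s = n.+2, path (@no_cancel _) b_letter s
                        & last b_letter s = b_letter].
  by case/mapP => t /closeP tP ->.
(* On W the rises lie in [-(n+2), n+2]; they are shifted into an ordinal. *)
pose f s : 'I_(2 * n + 4).+1 := inord `|(rise s + n.+2%:Z)%R|%N.
have [i le_i] := @pigeonhole _ _ f W (ltn0Sn _).
pose V := [seq s <- W | f s == i].
have VP s : s \in V -> [/\ size s = n.+2, path (@no_cancel _) b_letter s,
    last b_letter s = b_letter & rise s = (i : nat)%:Z - n.+2%:Z].
  rewrite mem_filter => /andP[/eqP fs /WP[sz pth lst]]; split=> //.
  have := norm_rise s; rewrite sz => tot.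
  have : `|(rise s + n.+2%:Z)%R|%N = i :> nat by rewrite -fs inordK //; lia.
  lia.
have uniqV : uniq V by rewrite filter_uniq.
exists [seq v ++ map mirror w | v <- V, w <- V]; split.
- apply: allpairs_uniq => // -[v w] [v' w'].
  move=> /allpairsP[[x y] /= [/VP[xz _ _ _] _ [-> ->]]].
  move=> /allpairsP[[x' y'] /= [/VP[xz' _ _ _] _ [-> ->]]] /eqP.
  rewrite eqseq_cat ?xz ?xz' // => /andP[/eqP -> /eqP].
  by move=> /(inj_map (inv_inj mirrorK)) ->.
- have szW : size W = (3 ^ n)%N by rewrite size_map size_ext.
  rewrite size_allpairs -szW expnS expn1 mulnACA.
  rewrite (_ : 2 * n + 5 = (2 * n + 4).+1)%N; last by lia.
  by rewrite leq_mul.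
- move=> _ /allpairsP[[v w] /= [/VP[vz vp vl vt] /VP[wz wp wl wt] ->]].
  have bE : b_letter = mirror b_letter by [].
  split.
  + by rewrite size_cat size_map vz wz mul2n addnn.
  + rewrite cat_path vp vl /= bE path_map.
    by rewrite (eq_path no_cancel_mirror).
  + by rewrite last_cat vl {1}bE last_map wl.
  + by rewrite rise_cat rise_mirror vt wt subrr.
Qed.

Fixpoint concats (S : seq word) m : seq word :=
  if m is m'.+1 then [seq w ++ u | w <- S, u <- concats S m'] else [:: [::]].

Lemma size_concats S m : size (concats S m) = (size S ^ m)%N.
Proof. by elim: m => [//|m IHm]; rewrite /= size_allpairs IHm expnS. Qed.

(** Each factor starts and ends at height [0] and is too short to leave the strip
    in between. *)
Lemma concatsP S m L k :
    (forall s, s \in S -> [/\ size s = L, path (@no_cancel _) b_letter s,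
       last b_letter s = b_letter & rise s = 0]) -> (L <= k)%N ->
  forall u, u \in concats S m -> [/\ size u = (m * L)%N,
    path (@no_cancel _) b_letter u & stays k 0 u 0].
Proof.
move=> SP Lk; elim: m => [|m IHm] u /=.
  by rewrite inE => /eqP ->; split.
case/allpairsP=> -[w v] /= [/SP[szw pw lw tw] /IHm[szv pv sv] ->]; split.
- by rewrite size_cat szw szv mulSn.
- by rewrite cat_path pw lw pv.
- rewrite stays_cat tw addr0 sv andbT.
  by have := @stays_short k 0 w; rewrite tw addr0; apply; rewrite normr0 szw; lia.
Qed.

Lemma uniq_concats S m L : uniq S -> (forall s, s \in S -> size s = L) ->
  uniq (concats S m).
Proof.
move=> uS szS; elim: m => [//|m IHm] /=; apply: allpairs_uniq => //.
move=> [w u] [w' u'] /allpairsP[[x y] /= [/szS xz _ [-> ->]]].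
move=> /allpairsP[[x' y'] /= [/szS xz' _ [-> ->]]] /eqP.
by rewrite eqseq_cat ?xz ?xz' // => /andP[/eqP -> /eqP ->].
Qed.

End Counting.

(** * Growth functions of subgroups *)

Section CardBounds.
Variable T : choiceType.
Implicit Types (A : set T) (r : seq T).

Lemma card_fset_set_le_size A r : (forall x, A x -> x \in r) ->
  (#|` fset_set A| <= size r)%N.
Proof.
move=> sub; have finA : finite_set A.
  by apply: sub_finite_set (finite_seq r) => x /sub.
apply: uniq_leq_size => [|x]; first exact: fset_uniq.
by rewrite (in_fset_set finA) => /set_mem /sub.
Qed.

Lemma size_le_card_fset_set A r : finite_set A -> uniq r ->
  (forall x, x \in r -> A x) -> (size r <= #|` fset_set A|)%N.
Proof.
move=> finA ur sub; apply: uniq_leq_size => // x /sub Ax.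
by rewrite (in_fset_set finA); apply/mem_set.
Qed.

End CardBounds.

Section Growth.
Variables (G : groupType) (g : 'I_2 -> G).
Hypothesis hg : free_generators g.
Variable b : G.
Implicit Types H : set G.

Local Notation ball H n :=
  (orbit_ball (fun h x : G => (h * x)%g) (cayley g) b H n).
Local Notation growth H n :=
  (growth_fun (fun h x : G => (h * x)%g) (cayley g) b H n).

(** An element [h] moves [b] by the length of the reduced word of
    [b^-1 * h * b]. *)
Lemma mem_ball H n h :
  ball H n h -> h \in [seq (b * ev g s / b)%g | s <- reduced_ball n].
Proof.
have [s sE] := ev_surj hg (b^-1 * (h * b))%g.
have hb : (h * b = b * ev g s)%g by rewrite -sE mulVKg.
case=> _; rewrite hb (gdist_cayley hg) => sz; apply/mapP; exists (reduce s).
  by apply: mem_reduced_ball => //; apply: reduce_reduced.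
by rewrite ev_reduce -hb mulgK.
Qed.

Lemma finite_ball H n : finite_set (ball H n).
Proof. by apply: sub_finite_set (finite_seq _) => h; apply: mem_ball. Qed.

Lemma growth_upper H n : (growth H n <= 4 * 3 ^ n)%N.
Proof.
apply: leq_trans (size_reduced_ball n).
rewrite -(size_map (fun s => b * ev g s / b)%g).
exact/card_fset_set_le_size/mem_ball.
Qed.

(** Concatenations of [m] words from [loops] have distinct values in the strip
    subgroup. Conjugation by the base point changes lengths by at most the
    constant [C]. *)
Lemma growth_lower n H : strip g (2 * n.+2) `<=` H ->
  exists N C : nat, (3 ^ n * 3 ^ n <= (2 * n + 5) ^ 2 * N)%N /\
    forall m, (N ^ m <= growth H (m * (2 * n.+2) + C))%N.
Proof.
move=> stripH; have [S [uS szS SP]] := loops n; have [c cE] := ev_surj hg b.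
exists (size S), (2 * size c)%N; split=> // m; rewrite -size_concats.
have uP := concatsP SP (leqnn _).
rewrite -(size_map (ev g)); apply: size_le_card_fset_set.
- exact: finite_ball.
- rewrite map_inj_in_uniq; last first.
    move=> u v /uP[_ pu _] /uP[_ pv _] /(ev_inj_reduce hg).
    by rewrite !reduce_id //; apply: path_sorted; [apply: pv|apply: pu].
  by apply: (@uniq_concats S m (2 * n.+2)) => // s /SP[].
- move=> _ /mapP[u /uP[szu _ stu] ->]; split; first by apply: stripH; exists u.
  have -> : (ev g u * b = b * ev g (winv c ++ u ++ c))%g.
    by rewrite !ev_cat ev_winv -cE mulVKg.
  rewrite (gdist_cayley hg); apply: leq_trans (size_reduce _) _.
  by rewrite !size_cat size_winv szu addnCA addnn mul2n (mul2n (size c)).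
Qed.

End Growth.

(** * Growth rates *)

Section RootLimsup.
Variable R : realType.
Implicit Types (c x y : R) (f : nat -> nat).

Lemma bernoulli_ineq (d : R) n : 0 <= d -> 1 + n%:R * d <= (1 + d) ^+ n.
Proof.
move=> d0; elim: n => [|n IHn]; first by rewrite mul0r addr0 expr0.
rewrite exprS -natr1; apply: le_trans (ler_wpM2l _ IHn); last by lra.
have : 0 <= (n%:R : R) by []; nra.
Qed.

(** Bernoulli's inequality for a square root of [x] gives a quadratic lower bound
    for [x ^+ n]. *)
Lemma linear_lt_exp x (A : R) : 1 < x -> \forall n \near \oo, A * n%:R < x ^+ n.
Proof.
move=> x1; pose d := Num.sqrt x - 1.
have d0 : 0 < d by rewrite subr_gt0 -sqrtr1 ltr_sqrt //; lra.
have xE : x = (1 + d) ^+ 2 by rewrite addrC subrK sqr_sqrtr //; lra.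
near=> n; have n_large : A / d ^+ 2 < n%:R by near: n; apply: nbhs_infty_gtr.
have n_pos : 0 < (n%:R : R) by near: n; apply: nbhs_infty_gtr.
rewrite xE exprAC; have := bernoulli_ineq n (ltW d0).
move: n_large; rewrite ltr_pdivrMr ?exprn_gt0 //.
set N : R := n%:R in n_pos *; set y := (1 + d) ^+ n => An bern.
have dN : 0 < N * d by rewrite mulr_gt0.
apply: lt_le_trans (_ : (N * d) ^+ 2 <= _); last by rewrite !expr2; nra.
by rewrite exprMn expr2 -mulrA [ltRHS]mulrC ltr_pM2r // mulrC.
Unshelve. all: by end_near. Qed.

Lemma root_exp c m : (0 < m)%N -> 0 <= c -> (c ^+ m) `^ m%:R^-1 = c.
Proof.
move=> m0 c0; have mN0 : (m%:R : R) != 0 by rewrite pnatr_eq0 -lt0n.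
by rewrite -powR_mulrn // -powRrM mulfV // powRr1.
Qed.

Lemma ler_root x y m : 0 <= x -> x <= y -> x `^ m%:R^-1 <= y `^ m%:R^-1.
Proof.
move=> x0 xy; apply: ge0_ler_powR; rewrite ?nnegrE ?invr_ge0 //.
exact: le_trans xy.
Qed.

Lemma limsup_root_ge c f : 0 <= c ->
    (forall n, exists2 m, (n < m)%N & c ^+ m <= (f m)%:R) ->
  (c%:E <= limn_esup (fun n => ((f n)%:R `^ n%:R^-1)%:E))%E.
Proof.
move=> c0 freq; rewrite limn_esup_lim; apply: lime_ge; first exact: is_cvg_esups.
apply: nearW => n; have [m nm le_f] := freq n.
apply: (@le_trans _ _ ((f m)%:R `^ m%:R^-1)%:E).
  rewrite lee_fin -{1}(root_exp (leq_ltn_trans (leq0n n) nm) c0).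
  by apply: ler_root => //; apply: exprn_ge0.
by apply: ereal_sup_ubound; exists m => //=; apply: ltnW.
Qed.

Lemma limsup_root_le c f : 0 <= c ->
    (\forall m \near \oo, (f m)%:R <= c ^+ m) ->
  (limn_esup (fun n => ((f n)%:R `^ n%:R^-1)%:E) <= c%:E)%E.
Proof.
move=> c0 ev_le; rewrite limn_esup_lim; apply: lime_le; first exact: is_cvg_esups.
case: ev_le => M _ leM; exists M.+1 => // n /= Mn.
apply: ge_ereal_sup => _ [m /= nm <-].
have m0 : (0 < m)%N by lia.
by rewrite lee_fin -(root_exp m0 c0) ler_root //; apply: leM => /=; lia.
Qed.

End RootLimsup.

Section CayleyRates.
Variables (R : realType) (G : groupType) (g : 'I_2 -> G).
Hypothesis hg : free_generators g.
Variable b : G.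
Implicit Types (H : set G) (c : R).

Lemma rate_le3 H : (cayley_growth_rate R g b H <= 3%:E)%E.
Proof.
apply/lee_addgt0Pr => e e0; rewrite -EFinD; apply: limsup_root_le; first by lra.
have /(linear_lt_exp 4) : 1 < (3 + e) / 3 by lra.
move=> lin; near=> m.
have m0 : (0 < m)%N by near: m; exists 1%N.
have : 4 * m%:R < ((3 + e) / 3) ^+ m by near: m.
rewrite expr_div_n ltr_pdivlMr ?exprn_gt0 // => lt_m.
apply: le_trans (ltW lt_m); apply: (@le_trans _ _ (4 * 3 ^ m)%:R).
  by rewrite ler_nat growth_upper.
rewrite natrM natrX; apply: ler_wpM2r; first exact: exprn_ge0.
by rewrite ler_peMr // ler1n.
Unshelve. all: by end_near. Qed.

(** With [N] words of length [L = 2(n + 2)] to concatenate, the growth rate is at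
    least the [L]-th root of [N]. It thus suffices that [c ^+ L < N], which holds
    for large [n] because [N] is at least [(3 ^ n / (2n + 5)) ^ 2]. *)
Lemma rate_ge c : 0 < c -> c < 3 ->
  \forall n \near \oo, forall H, strip g (2 * n.+2) `<=` H ->
    (c%:E <= cayley_growth_rate R g b H)%E.
Proof.
move=> c0 c3; have /(linear_lt_exp 63) lin : 1 < 3 / c by rewrite ltr_pdivlMr // mul1r.
near=> n => H /(growth_lower hg b)[N [C [le_N growN]]].
have n0 : (0 < n)%N by near: n; exists 1%N.
have lt_n : 63 * n%:R < (3 / c) ^+ n by near: n.
have cN : c ^+ (2 * n.+2) < N%:R.
  move: lt_n; rewrite expr_div_n ltr_pdivlMr ?exprn_gt0 // => lt_n.
  have lt1 : c ^+ n.+2 * (2 * n + 5)%:R < 3 ^+ n.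
    (* The constant 63 = 9 * 7 absorbs c ^ 2 <= 9 and 2 n + 5 <= 7 n. *)
    apply: le_lt_trans lt_n; rewrite !exprS mulrA [leRHS]mulrC [c * c * _]mulrC.
    rewrite -mulrA ler_pM2l ?exprn_gt0 //.
    apply: (@le_trans _ _ (9 * (7 * n)%:R)); last by rewrite natrM mulrA; lra.
    apply: ler_pM => //; [nra|nra|by rewrite ler_nat; lia].
  have D0 : 0 < ((2 * n + 5)%:R : R) ^+ 2 by rewrite exprn_gt0 // ltr0n addnS.
  rewrite -(ltr_pM2l D0) (mulnC _ n.+2) exprM -exprMn [_ * c ^+ _]mulrC.
  apply: (@lt_le_trans _ _ ((3 ^+ n) ^+ 2)).
    have base0 : 0 <= c ^+ n.+2 * (2 * n + 5)%:R.
      by rewrite mulr_ge0 // exprn_ge0 // ltW.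
    by rewrite [ltLHS]expr2 [ltRHS]expr2 ltr_pM.
  by rewrite expr2 -!natrX -!natrM ler_nat.
have N0 : 0 < (N%:R : R) by apply: lt_trans cN; apply: exprn_gt0.
pose L := (2 * n.+2)%N; pose q := N%:R / c ^+ L.
have q1 : 1 < q by rewrite ltr_pdivlMr ?exprn_gt0 // mul1r.
have /(linear_lt_exp (c ^+ C)) linq := q1.
apply: limsup_root_ge => [|p]; first exact: ltW.
have [M _ linM] := linq.
pose m := (M + p).+1.
exists (m * L + C)%N; first by rewrite /m /L; lia.
apply: (@le_trans _ _ (N%:R ^+ m)); last by rewrite -natrX ler_nat; apply: growN.
have : c ^+ C * m%:R < q ^+ m by apply: linM; rewrite /m /=; lia.
rewrite expr_div_n ltr_pdivlMr ?exprn_gt0 // => /ltW; apply: le_trans.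
have pow0 i : 0 <= c ^+ i by rewrite exprn_ge0 // ltW.
rewrite exprD (mulnC m) exprM [leLHS]mulrC.
apply: ler_wpM2r; first by rewrite -exprM.
by rewrite ler_peMr // ler1n.
Unshelve. all: by end_near. Qed.

End CayleyRates.

Theorem theorem9p4 (R : realType) (G : groupType) (g : 'I_2 -> G)
    (hg : free_generators g) :
  exists H : nat -> set G,
    (forall k : nat, [/\ subgroup (H k), infinite_index (H k)
                       & quasiconvex (cayley g) (H k)]) /\
    (forall b : G,
      (fun k : nat => cayley_growth_rate R g b (H k)) @ \oo --> (3%:E : \bar R) /\
      cayley_growth_rate R g b [set: G] = (3%:E : \bar R)).
Proof.
exists (fun k => strip g (2 * k.+2)); split=> [k|b].
  split; [exact: strip_subgroup | exact: strip_infinite_index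
         | exact: strip_quasiconvex].
have rate_near e : 0 < e -> \forall n \near \oo, forall H,
    strip g (2 * n.+2) `<=` H -> ((3 - e)%:E <= cayley_growth_rate R g b H)%E.
  move=> e0; have [e1|e1] := leP e 1; first by apply: rate_ge => //; lra.
  have /(rate_ge hg b) : (0 : R) < 2 by [].
  move=> /(_ ltac:(lra)); apply: filterS => n ge2 H /ge2; apply: le_trans.
  by rewrite lee_fin; lra.
split; last first.
  apply/eqP; rewrite eq_le rate_le3 //; apply/lee_subgt0Pr => e e0.
  by have [n _ /(_ n (leqnn n))] := rate_near e e0; rewrite -EFinB; apply.
(* Convergence in the extended reals is tested on the real values. *)
have near_real e : 0 < e -> \forall n \near \oo, exists2 r : R,
    cayley_growth_rate R g b (strip g (2 * n.+2)) = r%:E & `|3 - r| <= e.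
  move=> /rate_near; apply: filterS => n /(_ _ (fun _ => id)).
  have := rate_le3 R hg b (strip g (2 * n.+2)).
  case: cayley_growth_rate => [r| |] //; rewrite !lee_fin => r3 er.
  by exists r => //; rewrite ger0_norm; lra.
apply/fine_cvgP; split.
  by apply: filterS (near_real 1 ltr01) => n [r ->].
apply/cvgrPdist_le => e /near_real; apply: filterS => n [r rE le_e].
by rewrite /= rE.
Qed.
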